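(* Let $a<b$ be real numbers and let $g\in \mathrm{BV}((a,b))$ be a function with the property that there exist $\alpha,c>0$ and $0<\delta<b-a$ such that $g(x)-g^+(a)\ge c(x-a)^\alpha$ for all $x\in(a,a+\delta]$. Let $p\in[1,\infty]$, $\lambda>0$ and $\gamma>0$. If $$\gamma>\left(1+\frac1{p\alpha}\right)^{-1}=\frac{p\alpha}{p\alpha+1},$$ then $g$ is not a minimizer over $\mathrm{BV}((a,b))$ of the functional $$F(u)=\mathrm{TV}(u)+\lambda\|u-g\|_p^\gamma .$$ If instead $\gamma=\left(1+\frac1{p\alpha}\right)^{-1}$, the same conclusion holds provided that $$\lambda< K(p,\alpha)^{-\gamma/p}\,c^{\gamma/(p\alpha)} = K(p,\alpha)^{-\alpha/(1+p\alpha)}\,c^{1/(1+p\alpha)} .$$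
   Context: For an interval $I$ and $u:I\to\mathbb{R}$, $\mathrm{TV}(u)=\mathrm{TV}(u;I)$ is the pointwise total variation, i.e. the supremum of $\sum_{i=1}^n|u(x_i)-u(x_{i-1})|$ over finite sequences $x_0\le\dots\le x_n$ in $I$. $\mathrm{BV}(I)$ is the set of functions $u:I\to\mathbb{R}$ (defined everywhere) with $\mathrm{TV}(u;I)<\infty$. Such functions have one-sided limits everywhere; $g^+(a)=\lim_{x\to a^+}g(x)$. $\|\cdot\|_p$ is the $L^p$ norm on $(a,b)$. The constant is $$K(p,\alpha)=\frac{\Gamma(p+1)\,\Gamma(1/\alpha+1)}{\Gamma(p+1/\alpha+1)},$$ with $\Gamma$ Euler's Gamma function. For $p=\infty$ all expressions are interpreted as limits as $p\to\infty$: the threshold for $\gamma$ is $1$ and the bound on $\lambda$ in the equality case is $\lambda<1$. *)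

(* Defs.v *)
From HB Require Import structures.
From mathcomp Require Import all_boot all_order all_algebra.
From mathcomp Require Import all_classical all_reals all_analysis.
From mathcomp Require Import ring.

Set Implicit Arguments.
Unset Strict Implicit.
Unset Printing Implicit Defensive.

Import Order.TTheory GRing.Theory Num.Theory.
Import numFieldNormedType.Exports.

Local Open Scope classical_set_scope.
Local Open Scope ring_scope.

(* A function u : I -> R on an interval I is represented by a total function
   R -> R; everything below depends only on the values of u on I. *)

(* The library's total_variation is only for compact intervals; here I is
   arbitrary and the points x_0 <= ... <= x_n range over I. *)
Definition pointwise_TV (R : realType) (I : set R) (u : R -> R) : \bar R :=
  ereal_sup [set v | exists (n : nat) (x : nat -> R),
    [/\ forall i, (i <= n)%N -> I (x i),
        forall i, (i < n)%N -> x i <= x i.+1 &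
        v = (\sum_(i < n) `|u (x i.+1) - u (x i)|)%:E]].

Definition BV_on (R : realType) (I : set R) : set (R -> R) :=
  [set u | (pointwise_TV I u < +oo)%E].

(* The patch f \_ I is f on I and 0 outside I, so this is the L^p norm of f
   on I with respect to Lebesgue measure (p = +oo: essential supremum). *)
Definition Lnorm_on (R : realType) (I : set R) (p : \bar R) (f : R -> R) :
    \bar R :=
  Lnorm (@lebesgue_measure R) p (EFin \o (f \_ I)).

Definition tv_functional (R : realType) (I : set R) (p : \bar R)
    (lambda gamma : R) (g u : R -> R) : \bar R :=
  (pointwise_TV I u + lambda%:E * Lnorm_on I p (u \- g)%R `^ gamma)%E.

Definition minimizer_over (T : Type) (R : realType) (A : set T)
    (F : T -> \bar R) (u0 : T) : Prop :=
  A u0 /\ forall u, A u -> (F u0 <= F u)%E.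

(* Converges for s > 0. *)
Definition Gamma (R : realType) (s : R) : R :=
  \int[@lebesgue_measure R]_(t in `]0, +oo[) (t `^ (s - 1) * expR (- t)).

Definition Kconst (R : realType) (p alpha : R) : R :=
  Gamma (p + 1) * Gamma (alpha^-1 + 1) / Gamma (p + alpha^-1 + 1).

(* In the next two definitions the value at p = +oo is the limit of the
   finite-p expression (for the second one, with gamma = gamma_threshold p);
   the value at p = -oo is irrelevant since p >= 1. *)
Definition gamma_threshold (R : realType) (p : \bar R) (alpha : R) : R :=
  if p is r%:E then (1 + (r * alpha)^-1)^-1 else 1.

Definition lambda_bound (R : realType) (p : \bar R) (alpha c gamma : R) : R :=
  if p is r%:E
  then Kconst r alpha `^ (- gamma / r) * c `^ (gamma / (r * alpha))
  else 1.

Lemma gamma_thresholdE (R : realType) (r alpha : R) : 0 < r -> 0 < alpha ->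
  gamma_threshold r%:E alpha = r * alpha / (r * alpha + 1).
Proof.
move=> r0 a0 /=.
have ra : 0 < r * alpha by rewrite mulr_gt0.
by field; rewrite !gt_eqF //= addr_gt0.
Qed.

Lemma lambda_boundE (R : realType) (r alpha c gamma : R) :
  0 < r -> 0 < alpha -> gamma = gamma_threshold r%:E alpha ->
  lambda_bound r%:E alpha c gamma =
  Kconst r alpha `^ (- alpha / (1 + r * alpha)) *
  c `^ (1 / (1 + r * alpha)).
Proof.
move=> r0 a0 ->; rewrite gamma_thresholdE //=.
have ra : 0 < r * alpha by rewrite mulr_gt0.
have ra1 : 0 < r * alpha + 1 by rewrite addr_gt0.
have ra2 : 0 < 1 + r * alpha by rewrite addr_gt0.
by congr (_ `^ _ * _ `^ _); field; rewrite !gt_eqF.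
Qed.

(* Main.v *)
(* Raise g to the level g^+(a) + e on (a, a + delta]; for small e > 0 this leaves
   g(a + delta) unchanged, so the jump at a of height e is saved in the total
   variation.  The function added is at most (e - c(x-a)^alpha)_+, whose L^p norm
   to the power p is K(p,alpha) c^(-1/alpha) e^(p + 1/alpha).  Hence F changes by at
   most -e + lambda D e^theta with theta = gamma (1 + 1/(p alpha)) and
   D = (K c^(-1/alpha))^(gamma/p) (theta = gamma and D = 1 for p = oo), which is
   negative for small e when theta > 1
   and for every e when theta = 1 and lambda D < 1.  The Beta integral
   I_r = int (1 - s^alpha)_+^r ds is found without a change of variables s^alpha:
   integrating (e - s^alpha)_+^r exp(-e) in both orders gives
   I_r Gamma(r + 1/alpha + 1) = Gamma(r + 1) int exp(-s^alpha) ds, and the case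
   r = 0, where I_0 = 1, evaluates the last integral. *)
Require Import Defs.
From HB Require Import structures.
From mathcomp Require Import all_boot all_order all_algebra.
From mathcomp Require Import all_classical all_reals all_analysis.
From mathcomp Require Import measurable_realfun ess_sup_inf lra ring.

Set Implicit Arguments.
Unset Strict Implicit.
Unset Printing Implicit Defensive.

Import Order.TTheory GRing.Theory Num.Theory.
Import numFieldNormedType.Exports.

Local Open Scope classical_set_scope.
Local Open Scope ring_scope.

(** * Variation along finite paths, and the variation saved by raising the function near [a] *)

Section path_variation.
Variable R : realType.
Implicit Types (I : set R) (u g : R -> R) (x : R) (s : seq R).

(** The first point is kept apart from the list, so that points can be prepended or inserted by
    induction on the path. *)
Fixpoint path_variation u x s : R :=
  if s is y :: s' then `|u y - u x| + path_variation u y s' else 0.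

Lemma path_variation_sum u d x s :
  path_variation u x s =
  \sum_(i < size s) `|u (nth d (x :: s) i.+1) - u (nth d (x :: s) i)|.
Proof.
elim: s x => [|y s IH] x /=; first by rewrite big_ord0.
by rewrite big_ord_recl /= IH.
Qed.

Lemma path_variation_le_TV I u x s :
  path <=%R x s -> (forall y, y \in x :: s -> I y) ->
  ((path_variation u x s)%:E <= pointwise_TV I u)%E.
Proof.
move=> /(pathP x) xs Is; apply: ereal_sup_ubound.
exists (size s), (nth x (x :: s)); split => [i ilt|i /xs//|].
- by apply: Is; rewrite mem_nth.
- by rewrite (path_variation_sum _ x).
Qed.

Lemma pointwise_TV_ge0 I u x : I x -> (0 <= pointwise_TV I u)%E.
Proof.
move=> Ix; apply: le_trans (path_variation_le_TV u (x := x) (s := [::]) _ _) => //.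
by move=> y; rewrite inE => /eqP ->.
Qed.

Lemma path_variation_mkseq u (x : nat -> R) m n :
  path_variation u (x m) [seq x i | i <- iota m.+1 n] =
  \sum_(i < n) `|u (x (m + i).+1) - u (x (m + i)%N)|.
Proof.
elim: n m => [|n IH] m /=; first by rewrite big_ord0.
rewrite big_ord_recl /= addn0 IH; congr (_ + _).
by apply: eq_bigr => i _; rewrite /bump /= addnS addSn.
Qed.

Lemma partition_path I u n (x : nat -> R) :
  (forall i, (i <= n)%N -> I (x i)) ->
  (forall i, (i < n)%N -> x i <= x i.+1) ->
  exists s, [/\ path <=%R (x 0%N) s, forall y, y \in x 0%N :: s -> I y &
    \sum_(i < n) `|u (x i.+1) - u (x i)| = path_variation u (x 0%N) s].
Proof.
move=> Ix xx; exists [seq x i | i <- iota 1 n]; split.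
- apply/(pathP 0) => i; rewrite size_map size_iota => ilt.
  rewrite -[x 0%N :: _]/[seq x i | i <- iota 0 n.+1].
  rewrite !(nth_map 0%N) ?size_iota ?ltnS// 1?ltnW// !nth_iota ?ltnS// 1?ltnW//.
  exact: xx.
- move=> y; rewrite -[x 0%N :: _]/[seq x i | i <- iota 0 n.+1].
  by move=> /mapP[i]; rewrite mem_iota => /andP[_ ilt] ->; exact: Ix.
- by rewrite path_variation_mkseq.
Qed.

(** [lim] has a default value when there is no limit; this lemma makes the [lim] of the growth
    hypothesis a genuine $g^+(a)$. *)
Lemma BV_cvg_at_right (a b : R) g : a < b -> BV_on `]a, b[ g ->
  cvg (g y @[y --> a^'+]).
Proof.
move=> ab gBV; apply/cauchy_cvgP/cauchy_exP => e e0.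
have e20 : 0 < e / 2 by rewrite divr_gt0.
have m0 : `]a, b[%classic ((a + b) / 2) by rewrite /= in_itv/=; lra.
have TVfin : pointwise_TV `]a, b[ g \is a fin_num.
  by rewrite ge0_fin_numE//; exact: pointwise_TV_ge0 m0.
(* Left of a partition whose variation is within [e / 2] of the supremum, [g]
   varies by less than [e]. *)
have [_ [n [x [Ix xx ->]]] near_sup] := ub_ereal_sup_adherent e20 TVfin.
have [s [xs Is vE]] := partition_path g Ix xx.
rewrite {}vE -/(pointwise_TV _ _) in near_sup.
have /andP[ax xb] : a < x 0%N < b by have := Ix 0%N isT; rewrite /= in_itv.
have close y y' : a < y -> y <= y' -> y' < x 0%N -> `|g y' - g y| < e.
  move=> ay yy' y'x.
  have : ((path_variation g y [:: y', x 0%N & s])%:E <= pointwise_TV `]a, b[ g)%E.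
    apply: path_variation_le_TV; first by rewrite /= yy' (ltW y'x).
    by move=> v; rewrite inE => /orP[/eqP->|]; [|rewrite inE => /orP[/eqP->|/Is//]];
      rewrite /= in_itv/=; lra.
  move: near_sup; rewrite -(fineK TVfin) -EFinB lte_fin lee_fin /= => h1 h2.
  have := normr_ge0 (g (x 0%N) - g y'); lra.
exists (g ((a + x 0%N) / 2)).
suff : \forall y \near a^'+, ball (g ((a + x 0%N) / 2)) e (g y) by [].
near=> y.
have ya : a < y by near: y; exact: nbhs_right_gt.
have yx : y < x 0%N by near: y; exact: nbhs_right_lt.
rewrite /ball /=.
have [le|/ltW le] := leP y ((a + x 0%N) / 2); first by apply: close => //; lra.
by rewrite distrC; apply: close => //; lra.
Unshelve. all: by end_near. Qed.

(* [s'] is [s] with [z] inserted where the path crosses it, so that no step joins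
   the raised part of [u] to the part beyond [z] where [g] may drop below [l]. *)
Lemma raise_path_variation (a b z l : R) g x s : z < b -> l <= g z ->
  let u y := if y <= z then Num.max (g y) l else g y in
  path <=%R x s -> (forall y, y \in x :: s -> a < y < b) ->
  exists s', [/\ path <=%R x s', forall y, y \in x :: s' -> a < y < b &
    path_variation u x s + (u x - g x) <= path_variation g x s'].
Proof.
move=> zb lz u; have uz : u z = g z by rewrite /u lexx max_l.
(* In [p = max p t - (max p t - p)] the terms [max p t] and [-(max p t - p)] are both nondecreasing
   in [p], so [|p - q|] is the sum of their two variations. *)
have maxlip (p q t : R) : `|Num.max p t - Num.max q t| + (Num.max q t - q)
    <= `|p - q| + (Num.max p t - p).
  rewrite -lerBrDr ler_norml; have := ler_norm (p - q); have := ler_norm (q - p).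
  by rewrite (distrC q) /Num.max; do 2 case: ltP => ?; lra.
have ugt y : z < y -> u y = g y by rewrite /u ltNge => /negbTE ->.
(* The excess [u - g] at the start of a step is paid for by [g] or passed on to its end, so these
   inequalities telescope along the path. *)
have step x1 y : (x1 <= y <= z) || (z <= x1 <= y) ->
    `|u y - u x1| + (u x1 - g x1) <= `|g y - g x1| + (u y - g y).
  move=> /orP[/andP[xy yz]|/andP[zx xy]].
    rewrite /u yz (le_trans xy yz); exact: maxlip.
  have uE t : z <= t -> u t = g t.
    by rewrite le_eqVlt => /predU1P[<-//|/ugt].
  by rewrite !uE// ?(le_trans zx)// !subrr.
elim: s x => [|y s IH] x /=.
  move=> _ Ix; have /andP[ax xb] : a < x < b by apply: Ix; rewrite inE.
  have [zx|xz] := ltP z x.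
    by exists [::]; split => //=; rewrite ugt// subrr addr0.
  (* A path ending at or before [z] is prolonged to [z], where the excess vanishes. *)
  exists [:: z]; split => /=; first by rewrite xz.
    move=> v; rewrite !inE => /orP[/eqP->|/eqP->]; lra.
  have := @step x z; rewrite xz lexx => /(_ isT); rewrite uz.
  have := normr_ge0 (g z - u x); lra.
move=> /andP[xy ys] Ix.
have [||s' [ys' Is' le']] := IH y => //.
  by move=> v vs; apply: Ix; rewrite inE vs orbT.
have /andP[ax xb] : a < x < b by apply: Ix; rewrite inE eqxx.
have [side|] := boolP ((x <= y <= z) || (z <= x <= y)).
  exists (y :: s'); split => /=; first by rewrite xy.
    by move=> v; rewrite inE => /predU1P[->|/Is'//]; rewrite ax.
  have := step x y side; lra.
rewrite xy/= andbT negb_or -!ltNge => /andP[zy xz].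
exists [:: z, y & s']; split => /=; first by rewrite (ltW xz) (ltW zy).
  move=> v; rewrite inE => /predU1P[->|]; first by rewrite ax.
  by rewrite inE => /predU1P[->|/Is'//]; rewrite zb (lt_trans ax).
have := @step x z; rewrite lexx (ltW xz) => /(_ isT); rewrite uz.
have := ler_distD (g z) (u y) (u x); rewrite (ugt y zy).
rewrite (ugt y zy) in le'; lra.
Qed.

(** Prepend to a partition a point [y] so close to [a] that [g y < L + e]. The excess of the raised
    function at [y] is then more than [l - L - e], and [raise_path_variation] started at [y] charges
    it to the variation of [g]. *)
Lemma raise_pointwise_TV (a b z l L : R) g : a < z < b -> l <= g z ->
  g y @[y --> a^'+] --> L ->
  (pointwise_TV `]a, b[ (fun y => if (y <= z)%R then Num.max (g y) l else g y)
    + (l - L)%:E <= pointwise_TV `]a, b[ g)%E.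
Proof.
move=> /andP[az zb] lz gL; set u := (X in (pointwise_TV _ X + _)%E).
rewrite -leeBrDr//; apply: ub_ereal_sup => _ [n [x [Ix xx ->]]].
rewrite leeBrDr// -EFinD.
have [s [xs Is ->]] := partition_path u Ix xx.
apply/lee_addgt0Pr => e e0.
have /andP[ax xb] : a < x 0%N < b by have := Ix 0%N isT; rewrite /= in_itv.
near a^'+ => y.
have ya : a < y by near: y; exact: nbhs_right_gt.
have yx : y < x 0%N by near: y; exact: nbhs_right_lt.
have yz : y < z by near: y; exact: nbhs_right_lt.
have gy : `|L - g y| < e by near: y; exact: cvgr_dist_lt.
have [||s' [ys' Is' le']] := @raise_path_variation a b z l g y (x 0%N :: s) zb lz.
- by rewrite /= (ltW yx).
- move=> v; rewrite inE => /predU1P[->|/Is]; last by rewrite /= in_itv.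
  by rewrite ya (lt_trans yx).
have : ((path_variation g y s')%:E <= pointwise_TV `]a, b[ g)%E.
  by apply: path_variation_le_TV => // v /Is'; rewrite /= in_itv.
move=> /(leeD2r e%:E); apply: le_trans; rewrite -EFinD lee_fin.
move: le'; rewrite /= -/(u y) -/u (_ : u y = Num.max (g y) l); last first.
  by rewrite /u (ltW yz).
have : l <= Num.max (g y) l by rewrite le_max lexx orbT.
have := normr_ge0 (u (x 0%N) - Num.max (g y) l).
move: gy; rewrite ltr_norml => /andP[]; lra.
Unshelve. all: by end_near. Qed.

End path_variation.

(** * The integral of $(e - c s^\alpha)_+^r$: scaling and the identity with Gamma integrals *)

Section integrals.
Variable R : realType.
Notation mu := (@lebesgue_measure R).
Implicit Types (f : R -> \bar R) (k a : R).
Local Open Scope ereal_scope.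

(* The library's [ge0_le_integral] asks for measurability, which would have to be
   established for the BV function [g]. *)
Lemma ge0_le_integralT d (T : measurableType d)
    (m : {measure set T -> \bar R}) (f h : T -> \bar R) :
  (forall x, 0 <= f x) -> (forall x, f x <= h x) ->
  \int[m]_x f x <= \int[m]_x h x.
Proof.
move=> f0 fh; rewrite !ge0_integralTE//; last first.
  by move=> x; exact: le_trans (fh x).
by apply: le_ereal_sup => _ [s /= sf <-]; exists s => // x; exact: le_trans (fh x).
Qed.

Lemma affine_preimage_itv (k a x y : R) : (0 < k)%R ->
  (fun t : R => a + k * t)%R @^-1` `]x, y]%classic =
  `]((x - a) / k)%R, ((y - a) / k)%R]%classic.
Proof.
move=> k0; by apply/seteqP; split => t /=;
  rewrite !in_itv/= ltr_pdivrMr// ler_pdivlMr// ltrBlDl lerBrDl (mulrC t).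
Qed.

Lemma measurable_affine (k a : R) : measurable_fun [set: R] (fun t : R => a + k * t)%R.
Proof. by apply: measurable_funD => //; exact: measurable_funM. Qed.

(** Lebesgue measure and [k] times its image under [t |-> a + k * t] agree on half-open intervals,
    hence everywhere; the rest is integration against an image measure. *)
Lemma ge0_integral_affine (k a : R) f : (0 < k)%R ->
  measurable_fun [set: R] f -> (forall x, 0 <= f x) ->
  \int[mu]_x f x = k%:E * \int[mu]_x f (a + k * x)%R.
Proof.
move=> k0 mf f0.
pose phi (t : measurableTypeR R) : measurableTypeR R := (a + k * t)%R.
have mphi : measurable_fun setT phi by exact: measurable_affine.
have muE A : measurable A ->
    mu A = mscale (NngNum (ltW k0)) (pushforward mu phi) A.
  apply: lebesgue_measure_unique => _ [[x y] _ <-].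
  transitivity (k%:E * mu `]((x - a) / k)%R, ((y - a) / k)%R]%classic); last first.
    by congr (_ * mu _); rewrite -affine_preimage_itv.
  rewrite !lebesgue_measure_itv/=.
  rewrite !lte_fin ltr_pM2r ?invr_gt0// ltrD2r; case: ifPn => _; rewrite ?mule0//.
  by rewrite -!EFinD -EFinM; congr EFin; field; rewrite gt_eqF.
rewrite (eq_measure_integral _ (fun A mA _ => muE mphi A mA)).
by rewrite ge0_integral_mscale// ge0_integral_pushforward.
Qed.


(* The case distinction makes [pos_powR 0] the indicator of the positive reals,
   whereas [x `^ 0 = 1] for every [x]. *)
Definition pos_powR (r x : R) : R := if (0 < x)%R then (x `^ r)%R else 0%R.

Lemma pos_powR_ge0 r x : (0 <= pos_powR r x)%R.
Proof. by rewrite /pos_powR; case: ifP => // _; exact: powR_ge0. Qed.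

Lemma measurable_pos_powR r : measurable_fun [set: R] (pos_powR r).
Proof.
by apply: measurable_fun_ifT => //; exact: measurable_fun_ltr.
Qed.

Lemma pos_powRM r k x : (0 < k)%R -> pos_powR r (k * x) = (k `^ r * pos_powR r x)%R.
Proof.
move=> k0; rewrite /pos_powR pmulr_rgt0//; case: ifP => [x0|_].
  by rewrite powRM// ltW.
by rewrite mulr0.
Qed.

(** Extended-real form of [Gamma] on the whole line, so that Tonelli's theorem applies before
    finiteness is known. *)
Definition eGamma (s : R) : \bar R :=
  \int[mu]_t (pos_powR (s - 1) t * expR (- t))%:E.

(** The cut at [0 < s] discards the half line where the real power takes only default values. *)
Definition gap_kernel (r alpha c e s : R) : R :=
  (if 0 < s then pos_powR r (e - c * s `^ alpha) else 0)%R.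

Lemma gap_kernel_ge0 r alpha c e s : (0 <= gap_kernel r alpha c e s)%R.
Proof. by rewrite /gap_kernel; case: ifP => // _; exact: pos_powR_ge0. Qed.

Lemma measurable_gap_kernel2 r alpha c :
  measurable_fun [set: R * R] (fun z : R * R => gap_kernel r alpha c z.2 z.1).
Proof.
apply: measurable_fun_ifT => //; first exact: measurable_fun_ltr.
apply: (measurableT_comp (measurable_pos_powR r)).
apply: measurable_funB => //; apply: measurable_funM => //.
by apply: (measurableT_comp (measurable_powR alpha)).
Qed.

Lemma measurable_gap_kernel r alpha c e :
  measurable_fun [set: R] (gap_kernel r alpha c e).
Proof.
exact: (measurableT_comp (measurable_gap_kernel2 r alpha c) (pair2_measurable e)).
Qed.

Definition power_gap (r alpha c e : R) : \bar R :=
  \int[mu]_s (gap_kernel r alpha c e s)%:E.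

Lemma eGamma_integrand_ge0 s t : (0 <= pos_powR (s - 1) t * expR (- t))%R.
Proof. by rewrite mulr_ge0 ?pos_powR_ge0 ?expR_ge0. Qed.

Lemma measurable_expRN : measurable_fun [set: R] (fun t : R => expR (- t)).
Proof. by apply: (measurableT_comp (@measurable_expR R)); exact: measurable_funN. Qed.

Lemma measurable_eGamma_integrand s :
  measurable_fun [set: R] (fun t => pos_powR (s - 1) t * expR (- t))%R.
Proof.
exact: (measurable_funM (measurable_pos_powR (s - 1)) measurable_expRN).
Qed.

Lemma eGamma_ge0 s : 0 <= eGamma s.
Proof. by apply: integral_ge0 => t _; rewrite lee_fin eGamma_integrand_ge0. Qed.

Lemma power_gap_ge0 r alpha c e : 0 <= power_gap r alpha c e.
Proof. by apply: integral_ge0 => s _; rewrite lee_fin gap_kernel_ge0. Qed.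

(** Substituting [k * s] for [s] with [k^alpha = e / c] turns [c * s^alpha] into [e * s^alpha]; the
    kernel then yields [e^r] and the substitution yields [k]. *)
Lemma power_gap_scale r alpha c e : (0 < alpha)%R -> (0 < c)%R -> (0 < e)%R ->
  power_gap r alpha c e =
  (e `^ (r + alpha^-1) * c `^ (- alpha^-1))%:E * power_gap r alpha 1 1.
Proof.
move=> a0 c0 e0; pose k := ((e / c) `^ alpha^-1)%R.
have ec0 : (0 < e / c)%R by rewrite divr_gt0.
have k0 : (0 < k)%R by rewrite powR_gt0.
have kE : (k `^ alpha = e / c)%R by rewrite -powRrM mulVf ?gt_eqF// powRr1// ltW.
have kernelE s : gap_kernel r alpha c e (0 + k * s) =
    (e `^ r * gap_kernel r alpha 1 1 s)%R.
  rewrite /gap_kernel add0r pmulr_rgt0//; case: ifP => [s0|_]; last by rewrite mulr0.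
  rewrite powRM ?(ltW s0) ?(ltW k0)// kE -pos_powRM//; congr pos_powR.
  by field; rewrite gt_eqF.
rewrite /power_gap (ge0_integral_affine 0 k0); first last.
- by move=> s; rewrite lee_fin gap_kernel_ge0.
- by apply/measurable_EFinP; exact: measurable_gap_kernel.
under eq_integral do rewrite kernelE EFinM.
rewrite ge0_integralZl; first last.
- by rewrite lee_fin powR_ge0.
- by move=> s _; rewrite lee_fin gap_kernel_ge0.
- by apply/measurable_EFinP; exact: measurable_gap_kernel.
- exact: measurableT.
rewrite muleA -EFinM; congr (_%:E * _).
rewrite /k powRM ?(ltW e0) ?invr_ge0 ?(ltW c0)// powRD ?(gt_eqF e0)/= ?implybT//.
by rewrite -(powR_inv1 (ltW c0)) -powRrM mulN1r mulrC mulrA.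
Qed.

(* Both sides are the double integral of [(e - s^alpha)_+^r exp(-e)]: integrating
   first in [s] uses the homogeneity of [power_gap], first in [e] a translation. *)
Lemma power_gap_Gamma r alpha : (0 < alpha)%R -> (0 <= r)%R ->
  power_gap r alpha 1 1 * eGamma (r + alpha^-1 + 1) =
  eGamma (r + 1) * \int[mu]_s (if (0 < s)%R then expR (- s `^ alpha) else 0%R)%:E.
Proof.
move=> a0 r0; pose K (z : R * R) : R := gap_kernel r alpha 1 z.2 z.1.
have mKe : measurable_fun [set: R * R] (fun z : R * R => (K z * expR (- z.2))%:E).
  apply/measurable_EFinP.
  apply: (measurable_funM (measurable_gap_kernel2 r alpha 1)).
  exact: (measurableT_comp measurable_expRN measurable_snd).
have Ke0 z : 0 <= (K z * expR (- z.2))%:E.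
  by rewrite lee_fin mulr_ge0 ?expR_ge0 ?gap_kernel_ge0.
transitivity (\int[mu]_e \int[mu]_s (K (s, e) * expR (- e))%:E).
  rewrite /eGamma -ge0_integralZl; first last.
  - exact: power_gap_ge0.
  - by move=> t _; rewrite lee_fin eGamma_integrand_ge0.
  - by apply/measurable_EFinP; exact: measurable_eGamma_integrand.
  - exact: measurableT.
  apply: eq_integral => e _.
  under [RHS]eq_integral do rewrite mulrC EFinM.
  rewrite ge0_integralZl; first last.
  - by rewrite lee_fin expR_ge0.
  - by move=> s _; rewrite lee_fin gap_kernel_ge0.
  - by apply/measurable_EFinP; exact: measurable_gap_kernel.
  - exact: measurableT.
  rewrite -/(power_gap r alpha 1 e) mulrC EFinM muleCA; congr (_ * _).
  rewrite /pos_powR addrK; case: ifPn => [e0|]; last first.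
    rewrite -leNgt mule0 => e0; apply/esym/integral0_eq => s _.
    rewrite /gap_kernel; case: ifP => // s0.
    rewrite /pos_powR ifF//; apply/negbTE; rewrite -leNgt mul1r.
    by rewrite subr_le0 (le_trans e0)// powR_ge0.
  by rewrite [RHS]power_gap_scale// powR1 mulr1 muleC.
transitivity (\int[mu]_s \int[mu]_e (K (s, e) * expR (- e))%:E).
  exact/esym/(@fubini_tonelli _ _ _ _ R mu mu _ mKe Ke0).
rewrite -ge0_integralZl; first last.
- exact: eGamma_ge0.
- by move=> s _; rewrite lee_fin; case: ifP => // _; exact: expR_ge0.
- apply/measurable_EFinP; apply: measurable_fun_ifT.
  + exact: measurable_fun_ltr.
  + exact: (measurableT_comp measurable_expRN (measurable_powR alpha)).
  + exact: measurable_cst.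
- exact: measurableT.
apply: eq_integral => s _; rewrite /K/= /gap_kernel; case: ifPn => [s0|_]; last first.
  by rewrite mule0; apply: integral0_eq => e _; rewrite mul0r.
(* Shifting [e] by [s^alpha] splits off [exp(-s^alpha)] and leaves the integrand of
   [eGamma (r + 1)]. *)
rewrite (ge0_integral_affine (s `^ alpha) ltr01); first last.
- by move=> e; rewrite lee_fin mulr_ge0 ?pos_powR_ge0 ?expR_ge0.
- apply/measurable_EFinP; apply: measurable_funM measurable_expRN.
  apply: (measurableT_comp (measurable_pos_powR r)).
  by apply: measurable_funB.
rewrite mul1e; under eq_integral => e _.
  rewrite !mul1r addrAC subrr add0r opprD expRD mulrCA EFinM; over.
rewrite ge0_integralZl; first last.
- by rewrite lee_fin expR_ge0.
- by move=> e _; rewrite lee_fin mulr_ge0 ?pos_powR_ge0 ?expR_ge0.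
- apply/measurable_EFinP.
  exact: (measurable_funM (measurable_pos_powR r) measurable_expRN).
- exact: measurableT.
by rewrite muleC /eGamma addrK.
Qed.

End integrals.

(** * Finiteness and positivity of Gamma, and the value [Kconst] of the unit integral *)

Section Gamma_integrals.
Variable R : realType.
Notation mu := (@lebesgue_measure R).

Lemma Gamma_eGamma (s : R) : Gamma s = fine (eGamma s).
Proof.
rewrite /Gamma /Rintegral integral_mkcond; congr fine; apply: eq_integral => t _.
rewrite patchE mem_setE in_itv/= andbT /pos_powR; case: ifP => // _.
by rewrite mul0r.
Qed.

(** By [ln x < x], [q * ln (t / (2 * q + 1))] is at most [t / 2], so half of the exponential decay
    survives; the [+ 1] keeps the divisor positive at [q = 0]. *)
Lemma powR_expRN_le (q t : R) : 0 <= q -> 0 < t ->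
  t `^ q * expR (- t) <= expR (q * ln (2 * q + 1)) * expR (- 2^-1 * t).
Proof.
move=> q0 t0; rewrite /powR gt_eqF// -!expRD ler_expR.
have k0 : 0 < 2 * q + 1 by lra.
have -> : ln t = ln (t / (2 * q + 1)) + ln (2 * q + 1).
  by rewrite -lnM ?posrE ?divr_gt0// divfK// gt_eqF.
have /ltW/(ler_wpM2l q0) := ln_sublinear (divr_gt0 t0 k0); rewrite mulrDr.
have : q * (t / (2 * q + 1)) <= 2^-1 * t.
  rewrite mulrCA mulrC ler_wpM2r ?(ltW t0)// ler_pdivrMr//; lra.
lra.
Qed.

Local Open Scope ereal_scope.

Lemma eGamma_lty (s : R) : (1 <= s)%R -> eGamma s < +oo.
Proof.
move=> s1; set q := (s - 1)%R; have q0 : (0 <= q)%R by rewrite subr_ge0.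
(* The factor 2 cancels the rate in the exponential density of rate 1/2, which has integral 1. *)
pose C := (2 * expR (q * ln (2 * q + 1)))%R.
have C0 : (0 <= C)%R by rewrite mulr_ge0 ?expR_ge0.
have h0 : (0 < 2^-1 :> R)%R by rewrite invr_gt0.
apply: (@le_lt_trans _ _ (\int[mu]_t (C%:E * (exponential_pdf 2^-1 t)%:E))).
  apply: ge0_le_integralT => t; first by rewrite lee_fin eGamma_integrand_ge0.
  rewrite -EFinM lee_fin -/q /pos_powR; case: ifPn => [t0|_]; last first.
    by rewrite mul0r mulr_ge0// exponential_pdf_ge0// ltW.
  rewrite exponential_pdfE ?(ltW t0)// (le_trans (powR_expRN_le q0 t0))//.
  by rewrite /C; lra.
rewrite ge0_integralZl.
- by rewrite integral_exponential_pdf// mule1 ltry.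
- exact: measurableT.
- by apply/measurable_EFinP; exact: measurable_exponential_pdf.
- by move=> t _; rewrite lee_fin exponential_pdf_ge0// ltW.
- by rewrite lee_fin.
Qed.

Lemma eGamma_gt0 (s : R) : (1 <= s)%R -> 0 < eGamma s.
Proof.
move=> s1.
(* On (1, 2) the power is at least 1 and the exponential at least [exp(-2)]. *)
apply: (@lt_le_trans _ _ (\int[mu]_t
    ((expR (- 2))%:E * (\1_(`]1, 2[%classic : set R) t)%:E))).
  rewrite ge0_integralZl.
  - rewrite integral_indic//= setIT lebesgue_measure_itv/= lte_fin ltr1n.
    by rewrite -EFinD -EFinM lte_fin mulr_gt0 ?expR_gt0//; lra.
  - exact: measurableT.
  - by apply/measurable_EFinP; exact: measurable_indic.
  - by move=> t _; rewrite lee_fin.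
  - by rewrite lee_fin expR_ge0.
apply: ge0_le_integralT => t; rewrite -EFinM lee_fin.
  by rewrite mulr_ge0 ?expR_ge0.
rewrite indicE mem_setE in_itv/=; case: andP => [[t1 t2]|_]; last first.
  by rewrite mulr0 eGamma_integrand_ge0.
rewrite mulr1 /pos_powR (lt_trans _ t1)// -[leLHS]mul1r.
rewrite ler_pM ?expR_ge0// ?ler_expR ?lerN2 ?(ltW t2)//.
by rewrite -[leLHS](powRr0 t) ler_powR ?subr_ge0 ?(ltW t1).
Qed.

Lemma eGamma_fin_num (s : R) : (1 <= s)%R -> eGamma s \is a fin_num.
Proof. by move=> s1; rewrite ge0_fin_numE ?eGamma_lty// eGamma_ge0. Qed.

Lemma eGamma1 : eGamma (1 : R) = 1.
Proof.
rewrite -(@integral_exponential_pdf R 1 ltr01).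
transitivity (\int[mu]_(t in `]0%R, +oo[) (1 * expR (- 1 * t))%:E).
  rewrite [RHS]integral_mkcond; apply: eq_integral => t _.
  rewrite patchE mem_setE in_itv/= andbT /pos_powR; case: ifP => [t0|_].
    by rewrite subrr powRr0 mulN1r.
  by rewrite mul0r.
rewrite integral_itv_obnd_cbnd.
  rewrite integral_mkcond; apply: eq_integral => t _.
  by rewrite /exponential_pdf !patchE; case: ifP.
apply: measurable_funTS; apply/measurable_EFinP.
under eq_fun do rewrite mul1r mulN1r.
exact: measurable_expRN.
Qed.

Lemma power_gap0 (alpha : R) : (0 < alpha)%R -> power_gap 0 alpha 1 1 = 1.
Proof.
move=> a0; transitivity (\int[mu]_s (\1_(`]0, 1[%classic : set R) s)%:E).
  apply: eq_integral => s _; congr EFin.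
  rewrite /gap_kernel /pos_powR indicE mem_setE in_itv/=; case: ifPn => //= s0.
  rewrite subr_gt0 mul1r powRr0.
  have -> : (s `^ alpha < 1)%R = (s < 1)%R.
    have [s1|s1] := ltP s 1%R; last first.
      by apply/negbTE; rewrite -leNgt -[leLHS](powRr0 s) ler_powR// ltW.
    have := gt0_ltr_powR a0 _ _ s1; rewrite !nnegrE powR1.
    by move=> -> //; exact: ltW.
  by case: ifP.
rewrite integral_indic//= setIT lebesgue_measure_itv/= lte_fin ltr01.
by rewrite oppr0 adde0.
Qed.

Lemma power_gap_unit (r alpha : R) : (0 < alpha)%R -> (0 <= r)%R ->
  power_gap r alpha 1 1 = (Kconst r alpha)%:E /\ (0 < Kconst r alpha)%R.
Proof.
move=> a0 r0; have b0 : (0 <= alpha^-1)%R by rewrite invr_ge0 ltW.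
have := power_gap_Gamma a0 (lexx 0); rewrite power_gap0// !add0r eGamma1 !mul1e => Eb.
have := power_gap_Gamma a0 r0; rewrite -{}Eb /Kconst !Gamma_eGamma.
have fin1 : eGamma (r + 1) \is a fin_num by rewrite eGamma_fin_num// lerDr.
have fin2 : eGamma (alpha^-1 + 1) \is a fin_num by rewrite eGamma_fin_num// lerDr.
have fin3 : eGamma (r + alpha^-1 + 1) \is a fin_num.
  by rewrite eGamma_fin_num// lerDr addr_ge0.
have pos1 : (0 < fine (eGamma (r + 1)))%R by rewrite -lte_fin fineK// eGamma_gt0// lerDr.
have pos2 : (0 < fine (eGamma (alpha^-1 + 1)))%R.
  by rewrite -lte_fin fineK// eGamma_gt0// lerDr.
have pos3 : (0 < fine (eGamma (r + alpha^-1 + 1)))%R.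
  by rewrite -lte_fin fineK// eGamma_gt0// lerDr addr_ge0.
rewrite -[in X in X -> _](fineK fin1) -[in X in X -> _](fineK fin2).
rewrite -[in X in X -> _](fineK fin3) => E.
split; last by rewrite divr_gt0// mulr_gt0.
(* The identity lives in the extended reals: the value [+oo] is excluded because its product with a
   positive Gamma value would be infinite, while the other side is finite. *)
move: E (power_gap_ge0 r alpha 1 1); case: (power_gap r alpha 1 1) => [x| |//].
  by rewrite -!EFinM => -[<-] _; rewrite mulfK ?gt_eqF.
by rewrite gt0_mulye// -EFinM.
Qed.

End Gamma_integrals.

(** * Norm of the added function, and the comparison of [g] with its flattened competitor *)

Section flattening.
Variable R : realType.
Implicit Types (a b z alpha c e lambda gamma delta : R) (g w : R -> R) (p : \bar R).

(** This pointwise bound is all that the norm estimates use of the difference of competitor and [g];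
    no measurability is asked. *)
Definition gap_bounded a b alpha c e w :=
  forall x, a < x < b -> `|w x| <= Num.max 0 (e - c * (x - a) `^ alpha).

Lemma Lnorm_on_gap a b alpha c e r w :
  0 < alpha -> 0 < c -> 0 < e -> 1 <= r -> gap_bounded a b alpha c e w ->
  (Lnorm_on `]a, b[ r%:E w <=
   ((e `^ (r + alpha^-1) * c `^ (- alpha^-1) * Kconst r alpha) `^ r^-1)%:E)%E.
Proof.
move=> a0 c0 e0 r1 wb; have r0 : 0 < r by lra.
rewrite /Lnorm_on unlock -poweR_EFin.
have [KE K0] := power_gap_unit a0 (ltW r0).
(* The closed form is folded back into an integral so that the integrands can be compared. *)
rewrite EFinM -KE -power_gap_scale//.
apply: gt0_ler_poweR; rewrite ?invr_ge0 ?(ltW r0)//.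
- by rewrite in_itv/= leey andbT; apply: integral_ge0 => x _; rewrite lee_fin powR_ge0.
- by rewrite in_itv/= leey andbT power_gap_ge0.
rewrite /power_gap -[leRHS]mul1e.
have -> : (\int[@lebesgue_measure R]_s (gap_kernel r alpha c e s)%:E =
    \int[@lebesgue_measure R]_x (gap_kernel r alpha c e (- a + 1 * x))%:E)%E.
  rewrite [LHS](ge0_integral_affine (- a) ltr01) ?mul1e//.
    by apply/measurable_EFinP; exact: measurable_gap_kernel.
  by move=> x; rewrite lee_fin gap_kernel_ge0.
rewrite mul1e; apply: ge0_le_integralT => x; first by rewrite lee_fin powR_ge0.
rewrite /= lee_fin patchE mem_setE in_itv/=.
case: ifPn => [axb|_]; last by rewrite normr0 powR0 ?gap_kernel_ge0// gt_eqF.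
have := wb x axb; rewrite mul1r (addrC (- a)) /gap_kernel.
move/andP: axb => [ax xb]; rewrite subr_gt0 ax /pos_powR; case: ltP => [pos|_] wx.
  by rewrite ge0_ler_powR ?nnegrE ?(ltW r0) ?(ltW pos).
by rewrite (_ : `|w x| = 0) ?powR0 ?gt_eqF//; apply/eqP; rewrite eq_le wx normr_ge0.
Qed.

Lemma Lnorm_on_gap_infty a b alpha c e w :
  0 < c -> 0 < e -> gap_bounded a b alpha c e w ->
  (Lnorm_on `]a, b[ +oo w <= e%:E)%E.
Proof.
move=> c0 e0 wb; rewrite /Lnorm_on unlock.
(* The norm for [p = +oo] is an essential supremum, with default value 0 if the whole space is
   null. *)
case: ifPn => _; last by rewrite lee_fin ltW.
apply/ess_supP/nearW => x /=; rewrite lee_fin patchE mem_setE in_itv/=.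
case: ifPn => [axb|_]; last by rewrite normr0 ltW.
apply: le_trans (wb x axb) _; rewrite ge_max (ltW e0)/= lerBlDr lerDl.
by rewrite mulr_ge0 ?powR_ge0 ?(ltW c0).
Qed.

Lemma not_minimizer_of_gap a b g alpha c delta p lambda gamma e :
  BV_on `]a, b[ g -> 0 < c -> 0 < delta -> delta < b - a ->
  (forall x, x \in `]a, a + delta] ->
    c * (x - a) `^ alpha <= g x - lim (g y @[y --> a^'+])) ->
  0 < lambda -> 0 < e -> e <= c * delta `^ alpha ->
  (forall w, gap_bounded a b alpha c e w ->
    (lambda%:E * Lnorm_on `]a, b[ p w `^ gamma < e%:E)%E) ->
  ~ minimizer_over (BV_on `]a, b[) (tv_functional `]a, b[ p lambda gamma g) g.
Proof.
move=> gBV c0 d0 dab; set L := lim _ => grow l0 e0 ed small [_ gmin].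
have ab : a < b by lra.
have gL : g y @[y --> a^'+] --> L by exact: BV_cvg_at_right ab gBV.
pose z := a + delta; pose u y := if y <= z then Num.max (g y) (L + e) else g y.
have az : a < z < b by rewrite /z; lra.
(* Growth at [z] together with [e <= c * delta^alpha]: the new level does not exceed [g z], so [u]
   and [g] agree there. *)
have lz : L + e <= g z.
  have := grow z; rewrite /z in_itv/= lexx ltrDl d0 => /(_ isT).
  rewrite addrAC subrr add0r; lra.
have := raise_pointwise_TV az lz gL; rewrite -/u addrAC subrr add0r => TVu.
have Iz : [set` `]a, b[] z by rewrite /= in_itv.
have uBV : BV_on `]a, b[ u.
  rewrite /BV_on/=; move: gBV; apply: le_lt_trans.
  by apply: le_trans TVu; rewrite leeDl// lee_fin ltW.
have wb : gap_bounded a b alpha c e (u \- g).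
  move=> x /andP[ax xb] /=; rewrite /u; case: ifPn => [xz|_]; last first.
    by rewrite subrr normr0 le_max lexx.
  have := grow x; rewrite in_itv/= ax xz => /(_ isT) gx.
  have [h|h] := leP (g x) (L + e).
    by rewrite ger0_norm ?subr_ge0// le_max; apply/orP; right; lra.
  by rewrite subrr normr0 le_max lexx.
have := gmin u uBV; apply/negP; rewrite -ltNge.
apply: (@lt_le_trans _ _ (pointwise_TV `]a, b[ g)); last first.
  by rewrite /tv_functional leeDl// mule_ge0 ?lee_fin ?(ltW l0)// poweR_ge0.
apply: lt_le_trans TVu; rewrite /tv_functional.
(* Cancelling the variation of [u] requires it to be finite, which is [uBV]. *)
rewrite lteD2lE ?small//.
by rewrite ge0_fin_numE//; exact: pointwise_TV_ge0 Iz.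
Qed.

(** For [theta = 1] the choice [e = m] works. For [theta > 1] the bound [e^(theta - 1) <= k] makes
    [lambda * D * e^(theta - 1)] at most 1/2. *)
Lemma small_power lambda D theta m : 0 < lambda -> 0 < D -> 0 < m ->
  1 < theta \/ theta = 1 /\ lambda * D < 1 ->
  exists e, [/\ 0 < e, e <= m & lambda * (D * e `^ theta) < e].
Proof.
move=> l0 D0 m0 [th|[-> lD]]; last first.
  by exists m; split => //; rewrite powRr1 ?(ltW m0)// mulrA gtr_pMl.
have lD0 : 0 < 2 * (lambda * D) by rewrite !mulr_gt0.
have t0 : 0 < theta - 1 by rewrite subr_gt0.
pose k := (2 * (lambda * D))^-1; have k0 : 0 < k by rewrite invr_gt0.
pose e := Num.min m (k `^ (theta - 1)^-1).
have e0 : 0 < e by rewrite lt_min m0 powR_gt0.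
exists e; split => //; first by rewrite ge_min lexx.
have ek : e `^ (theta - 1) <= k.
  have -> : k = (k `^ (theta - 1)^-1) `^ (theta - 1).
    by rewrite -powRrM mulVf ?gt_eqF// powRr1// ltW.
  by rewrite ge0_ler_powR ?nnegrE ?powR_ge0 ?(ltW e0) ?(ltW t0)// ge_min lexx orbT.
rewrite -(mulr_powRB1 (ltW e0)); last by lra.
rewrite mulrA mulrCA gtr_pMr//.
apply: le_lt_trans (ler_wpM2l _ ek) _; first by rewrite mulr_ge0 ?ltW.
rewrite /k invfM mulrCA divff ?mulr1; first by rewrite invf_lt1// ltr1n.
by rewrite gt_eqF// mulr_gt0.
Qed.

End flattening.

(** * Reduction of both cases to one power bound on the penalty *)

Theorem theorem3p4 (R : realType) (a b : R) (hab : a < b)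
  (g : R -> R) (hg : BV_on `]a, b[ g)
  (alpha c delta : R) (halpha : 0 < alpha) (hc : 0 < c)
  (hdelta0 : 0 < delta) (hdelta : delta < b - a)
  (hgrow : forall x : R, x \in `]a, a + delta] ->
    c * (x - a) `^ alpha <= g x - lim (g y @[y --> a^'+]))
  (p : \bar R) (hp : (1%:E <= p)%E)
  (lambda gamma : R) (hlambda : 0 < lambda) (hgamma : 0 < gamma) :
  (gamma_threshold p alpha < gamma ->
    ~ minimizer_over (BV_on `]a, b[) (tv_functional `]a, b[ p lambda gamma g) g)
  /\
  (gamma = gamma_threshold p alpha ->
    lambda < lambda_bound p alpha c gamma ->
    ~ minimizer_over (BV_on `]a, b[) (tv_functional `]a, b[ p lambda gamma g) g).
Proof.
suff main : gamma_threshold p alpha < gamma \/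
    gamma = gamma_threshold p alpha /\ lambda < lambda_bound p alpha c gamma ->
    ~ minimizer_over (BV_on `]a, b[) (tv_functional `]a, b[ p lambda gamma g) g.
  by split => [?|? ?]; apply: main; [left|right].
have m0 : 0 < c * delta `^ alpha by rewrite mulr_gt0 ?powR_gt0.
(* Finite and infinite [p] differ only in [D] and [theta]; [sharp] translates the conditions on
   [gamma] and [lambda] into those of [small_power]. *)
suff [D [theta [D0 sharp bound]]] : exists D theta, [/\ 0 < D,
      gamma_threshold p alpha < gamma \/
        gamma = gamma_threshold p alpha /\ lambda < lambda_bound p alpha c gamma ->
        1 < theta \/ theta = 1 /\ lambda * D < 1 &
      forall e w, 0 < e -> gap_bounded a b alpha c e w ->
        (Lnorm_on `]a, b[ p w `^ gamma <= (D * e `^ theta)%:E)%E].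
  move=> /sharp /(small_power hlambda D0 m0)[e [e0 em elt]].
  apply: (not_minimizer_of_gap hg hc hdelta0 hdelta hgrow hlambda e0 em) => w wb.
  apply: (@le_lt_trans _ _ (lambda * (D * e `^ theta))%:E); last by rewrite lte_fin.
  by rewrite EFinM lee_wpmul2l ?lee_fin ?(ltW hlambda)//; exact: bound.
have normle p' w x : 0 <= x -> (Lnorm_on `]a, b[ p' w <= x%:E)%E ->
    (Lnorm_on `]a, b[ p' w `^ gamma <= (x `^ gamma)%:E)%E.
  move=> x0 le; rewrite -poweR_EFin.
  apply: gt0_ler_poweR; rewrite ?(ltW hgamma)// in_itv/= leey andbT ?lee_fin//.
  exact: Lnorm_ge0.
case: p hp => [r| |//]; last first.
  move=> _; exists 1, gamma; split => //= [[?|[-> ?]]|e w e0 wb].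
  - by left.
  - by right; rewrite mulr1.
  - rewrite mul1r; apply: normle; first exact: ltW.
    exact: Lnorm_on_gap_infty hc e0 wb.
rewrite lee_fin => r1; have r0 : 0 < r by lra.
have [_ K0] := power_gap_unit halpha (ltW r0).
have ra0 : 0 < r * alpha by rewrite mulr_gt0.
(* [D] is the part free of [e] in the bound of [Lnorm_on_gap], after raising it to the power
   [gamma]. *)
pose D := (c `^ (- alpha^-1) * Kconst r alpha) `^ (gamma / r).
have D0 : 0 < D by apply: powR_gt0; rewrite mulr_gt0 ?powR_gt0.
have thresholdE : gamma_threshold r%:E alpha = (1 + (r * alpha)^-1)^-1 by [].
have thetaE : (r + alpha^-1) * (gamma / r) = gamma * (1 + (r * alpha)^-1).
  by field; rewrite !gt_eqF.
have s0 : 0 < 1 + (r * alpha)^-1 by rewrite addr_gt0 ?invr_gt0.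
exists D, ((r + alpha^-1) * (gamma / r)); split => //.
  rewrite thetaE thresholdE => -[lt|[gE lt]]; first by left; rewrite -ltr_pdivrMr// div1r.
  right; split; first by rewrite gE mulVf ?gt_eqF.
  (* [lambda_bound] is exactly the inverse of [D]. *)
  rewrite -[ltRHS](mulVf (lt0r_neq0 D0)) ltr_pM2r//; apply: lt_le_trans lt _.
  rewrite /D powRM ?powR_ge0 ?(ltW K0)// -powRrM invfM -!powRN mulNr.
  rewrite [leLHS]mulrC le_eqVlt; apply/orP; left; apply/eqP.
  by congr (_ `^ _ * _ `^ _); field; rewrite !gt_eqF.
move=> e w e0 wb.
have := normle _ w _ (powR_ge0 _ _) (Lnorm_on_gap halpha hc e0 r1 wb).
rewrite -[X in (_ <= X%:E)%E -> _]powRrM (mulrC r^-1) -mulrA powRM; first last.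
- by rewrite mulr_ge0 ?powR_ge0 ?(ltW K0).
- exact: powR_ge0.
by rewrite -powRrM (mulrC D).
Qed.
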